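(* A ring $R$ (with unity) is von Neumann regular if and only if every $R$-module is trace in an fp-injective preenvelope (of it) up to isomorphism.
   Context: $R$ is not necessarily commutative; modules are left modules. An $R$-module $I$ is fp-injective if $\operatorname{Ext}^1_R(F,I)=0$ for each finitely presented $R$-module $F$. An fp-injective preenvelope of an $R$-module $M$ is an $R$-homomorphism $\varphi:M\to V$ with $V$ fp-injective such that for any $\psi:M\to V'$ with $V'$ fp-injective there exists $\alpha:V\to V'$ with $\alpha\varphi=\psi$. For $R$-modules $M,X$, the trace module of $M$ in $X$ is $\tau_M(X)=\sum_{\alpha\in\operatorname{Hom}_R(M,X)}\alpha(M)\subseteq X$. A submodule $M\subseteq X$ is a trace submodule of $X$ if $M=\tau_N(X)$ for some $R$-module $N$. $M$ is trace in $X$ up to isomorphism if there exists an injective $R$-homomorphism $\iota:M\to X$ such that $\operatorname{Im}(\iota)$ is a trace submodule of $X$. *)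

(* Defs.v *)
From HB Require Import structures.
From mathcomp Require Import all_boot all_order all_algebra.
From mathcomp Require Import all_classical.

Set Implicit Arguments.
Unset Strict Implicit.
Unset Printing Implicit Defensive.

Import GRing.Theory.
Local Open Scope classical_set_scope.
Local Open Scope ring_scope.

(* [pzRingType] rather than [nzRingType], so that the zero ring is included. *)

Definition von_neumann_regular (R : pzRingType) : Prop :=
  forall a : R, exists x : R, a = a * x * a.

Section Modules.
Variable R : pzRingType.
Implicit Types M N X F I P V : lmodType R.

Definition linear_ker (A B : lmodType R) (f : {linear A -> B}) : set A :=
  f @^-1` [set 0].

Definition exact_at (A B C : lmodType R)
    (f : {linear A -> B}) (g : {linear B -> C}) : Prop :=
  range f = linear_ker g.

Definition finitely_presented F : Prop :=
  exists (m n : nat) (f : {linear 'rV[R]_m -> 'rV[R]_n})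
         (g : {linear 'rV[R]_n -> F}),
    exact_at f g /\ range g = setT.

Definition projective P : Prop :=
  forall (A B : lmodType R) (p : {linear A -> B}) (f : {linear P -> B}),
    range p = setT -> exists g : {linear P -> A}, p \o g =1 f.

Record projective_resolution F := ProjectiveResolution {
  res_mod : nat -> lmodType R;
  res_diff : forall n, {linear res_mod n.+1 -> res_mod n};
  res_aug : {linear res_mod 0 -> F};
  res_projective : forall n, projective (res_mod n);
  res_exact : forall n, exact_at (res_diff n.+1) (res_diff n);
  res_exact0 : exact_at (res_diff 0) res_aug;
  res_aug_surj : range res_aug = setT
}.

(* Degree-1 cocycles and coboundaries of the complex Hom(P_*, I). *)
Definition cocycle1 F I (P : projective_resolution F)
    (f : {linear res_mod P 1 -> I}) : Prop :=
  forall x : res_mod P 2, f (res_diff P 1 x) = 0.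

Definition coboundary1 F I (P : projective_resolution F)
    (f : {linear res_mod P 1 -> I}) : Prop :=
  exists g : {linear res_mod P 0 -> I}, f =1 g \o res_diff P 0.

(* Ext^1(F, I) = H^1(Hom(P_*, I)) vanishes.  The group does not depend, up to
   isomorphism, on the resolution, and every module has a free resolution, so
   quantifying over all resolutions is the same as fixing one. *)
Definition Ext1_eq0 F I : Prop :=
  forall (P : projective_resolution F) (f : {linear res_mod P 1 -> I}),
    cocycle1 f -> coboundary1 f.

Definition fp_injective I : Prop :=
  forall F, finitely_presented F -> Ext1_eq0 F I.

Definition fp_injective_preenvelope M V (phi : {linear M -> V}) : Prop :=
  fp_injective V /\
  forall (V' : lmodType R) (psi : {linear M -> V'}), fp_injective V' ->
    exists alpha : {linear V -> V'}, alpha \o phi =1 psi.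

(* The sum of the images alpha(M): finite sums of elements alpha_i(m_i). *)
Definition trace_module M X : set X :=
  [set x | exists (n : nat) (alpha : 'I_n -> {linear M -> X}) (m : 'I_n -> M),
     x = \sum_(i < n) alpha i (m i)].

Definition trace_submodule X (S : set X) : Prop :=
  exists N, S = @trace_module N X.

Definition trace_up_to_iso M X : Prop :=
  exists iota : {linear M -> X}, injective iota /\ trace_submodule (range iota).

End Modules.

(* Main.v *)
(* If [R] is von Neumann regular, so are its rectangular matrices, hence every
   finitely presented module is projective, every module is fp-injective, and
   the identity is a preenvelope.  Conversely, apply the hypothesis to [R + I]
   for an arbitrary module [I]: a trace submodule of [V] isomorphic to a
   generator is all of [V], so [R + I], and with it [I], is fp-injective.  For
   [I = R a], [Ext^1(R / R a, R a) = 0] makes [R a] a direct summand of [R],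
   and the image of [1] under a projection onto [R a] is some [x a] with
   [a x a = a]. *)

From HB Require Import structures.
Require Import Defs.
From mathcomp Require Import all_boot all_order all_algebra.
From mathcomp Require Import finmap all_classical.

Set Implicit Arguments.
Unset Strict Implicit.
Unset Printing Implicit Defensive.

Import GRing.Theory.
Local Open Scope classical_set_scope.
Local Open Scope ring_scope.

(** * Von Neumann regularity of rectangular matrices *)

Section RegularMatrices.
Variable R : pzRingType.

Definition mx_regular m n (A : 'M[R]_(m, n)) : Prop :=
  exists X : 'M[R]_(n, m), A = A *m X *m A.

(* McCoy's lemma: it reduces a block matrix to a triangular one, and that one
   to its lower left block. *)
Lemma mx_regular_sub m n (A : 'M[R]_(m, n)) (X : 'M[R]_(n, m)) :
  mx_regular (A - A *m X *m A) -> mx_regular A.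
Proof.
(* With [B = A - A X A = B Y B], the factorizations [B = A (1 - X A) = (1 - A X) A] put [B Y B] in
   the form [A _ A]. *)
case=> Y AY; exists (X + (1%:M - X *m A) *m Y *m (1%:M - A *m X)).
apply/eqP; rewrite [_ *m (X + _)]mulmxDr mulmxDl addrC -subr_eq.
apply/eqP; rewrite [LHS]AY.
by rewrite !(mulmxA, mulmxBr, mulmxBl, mulmx1, mul1mx).
Qed.

Lemma mx_regular_block m1 m2 n1 n2 :
  (forall A : 'M[R]_(m1, n1), mx_regular A) ->
  (forall A : 'M[R]_(m1, n2), mx_regular A) ->
  (forall A : 'M[R]_(m2, n1), mx_regular A) ->
  (forall A : 'M[R]_(m2, n2), mx_regular A) ->
  forall A : 'M[R]_(m1 + m2, n1 + n2), mx_regular A.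
Proof.
move=> reg11 reg12 reg21 reg22.
have reg_dl (C : 'M[R]_(m2, n1)) :
    mx_regular (block_mx 0 0 C 0 : 'M_(m1 + m2, n1 + n2)).
  have [X CX] := reg21 C; exists (block_mx 0 X 0 0).
  by rewrite !mulmx_block !(mulmx0, mul0mx, addr0, add0r) -CX.
have reg_low (A : 'M[R]_(m1, n1)) (C : 'M[R]_(m2, n1)) (D : 'M[R]_(m2, n2)) :
    mx_regular (block_mx A 0 C D).
  have [X AX] := reg11 A; have [Y DY] := reg22 D.
  (* This inner inverse cancels both diagonal blocks, leaving only the lower left one. *)
  apply: (@mx_regular_sub _ _ _ (block_mx X 0 0 Y)).
  rewrite !mulmx_block !(mulmx0, mul0mx, addr0, add0r) -AX -DY.
  by rewrite opp_block_mx add_block_mx !subrr; apply: reg_dl.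
move=> A; rewrite -[A]submxK; have [X BX] := reg12 (ursubmx A).
(* With [X] in the lower left corner, only [B - B X B = 0] remains in the upper right block [B]. *)
apply: (@mx_regular_sub _ _ _ (block_mx 0 0 X 0)).
rewrite !mulmx_block !(mulmx0, mul0mx, addr0, add0r) -BX.
by rewrite opp_block_mx add_block_mx subrr; apply: reg_low.
Qed.

Lemma mx_regular_all : von_neumann_regular R ->
  forall m n (A : 'M[R]_(m, n)), mx_regular A.
Proof.
move=> regR.
have reg_0n n (A : 'M[R]_(0, n)) : mx_regular A.
  by exists 0; rewrite [LHS]flatmx0 [RHS]flatmx0.
have reg_m0 m (A : 'M[R]_(m, 0)) : mx_regular A.
  by exists 0; rewrite [LHS]thinmx0 [RHS]thinmx0.
have reg_11 (A : 'M[R]_1) : mx_regular A.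
  rewrite [A]mx11_scalar; have [x ax] := regR (A 0 0).
  by exists x%:M; rewrite -!scalar_mxM -ax.
have reg_1n n (A : 'M[R]_(1, n)) : mx_regular A.
  elim: n A => [|n IHn]; first exact: reg_m0.
  (* The first entry is split off; the lower blocks have no rows. In the induction on rows below, it
     is the left blocks that have no columns. *)
  by apply: (@mx_regular_block 1 0 1 n).
elim=> [|m IHm] n; first exact: reg_0n.
by apply: (@mx_regular_block 1 m 0 n).
Qed.

End RegularMatrices.

(** * Construction of linear maps *)

Section LinearMaps.
Variable R : pzRingType.

Definition Linear (A B : lmodType R) (f : A -> B) (lin_f : linear f) :
    {linear A -> B} :=
  HB.pack f (GRing.isLinear.Build R A B *:%R f lin_f).

(* The linear map induced by the relation [p a = h c], which contains the
   graph of every inverse, corestriction or factorization needed here. *)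
Lemma linear_lift (A B C D : lmodType R)
    (p : {linear A -> B}) (f : {linear A -> D}) (h : {linear C -> B}) :
  (forall a, p a = 0 -> f a = 0) -> (forall c, exists a, p a = h c) ->
  exists g : {linear C -> D}, forall c a, p a = h c -> g c = f a.
Proof.
move=> kerp ranh; have [s sP] := choice ranh.
have fP a a' : p a = p a' -> f a = f a'.
  move=> paa'; apply/eqP; rewrite -subr_eq0 -linearB; apply/eqP/kerp.
  by rewrite linearB paa' subrr.
have lin : linear (f \o s).
  by move=> k x y /=; rewrite -linearP; apply: fP; rewrite linearP !sP linearP.
by exists (Linear lin) => c a pa /=; apply: fP; rewrite sP.
Qed.

Lemma projective_rV n : projective ('rV[R]_n : lmodType R).
Proof.
move=> A B p f surj_p.
have /choice[c cP] (j : 'I_n) : exists a, p a = f (delta_mx 0 j).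
  have [a _ <-] : range p (f (delta_mx 0 j)) by rewrite surj_p.
  by exists a.
have lin : linear (fun x : 'rV[R]_n => \sum_j x 0 j *: c j).
  move=> k x y; rewrite scaler_sumr -big_split; apply: eq_bigr => j _.
  by rewrite !mxE scalerDl scalerA.
exists (Linear lin) => x /=; rewrite [in RHS](row_sum_delta x) !linear_sum.
by apply: eq_bigr => j _; rewrite !linearZ cP.
Qed.

End LinearMaps.

(** * Image and cokernel of a linear map as modules *)

Section ImageCokernel.
Variables (R : pzRingType) (A B : lmodType R) (f : {linear A -> B}).

Definition in_range (y : B) : bool := `[< range f y >].

Lemma in_rangeP y : reflect (exists x, f x = y) (y \in in_range).
Proof.
by apply: (iffP (asboolP (range f y))) => [[x _ <-]|[x <-]]; exists x.
Qed.

Lemma in_range_submod_closed : GRing.submod_closed in_range.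
Proof.
split=> [|k _ _ /in_rangeP[x <-] /in_rangeP[y <-]]; apply/in_rangeP.
  by exists 0; rewrite linear0.
by exists (k *: x + y); rewrite linearP.
Qed.

HB.instance Definition _ := GRing.isSubmodClosed.Build R B in_range
  (GRing.submod_closed_semi in_range_submod_closed).

Record image_module := ImageModule {
  image_val :> B; _ : image_val \in in_range }.
HB.instance Definition _ := [isSub for image_val].
HB.instance Definition _ := [Choice of image_module by <:].
HB.instance Definition _ := [SubChoice_isSubLmodule of image_module by <:].

Definition cokernel : Type :=
  Quotient.quot (GRing.ZmodClosed.clone B in_range _).
HB.instance Definition _ := GRing.Zmodule.on cokernel.

Definition coker_proj (y : B) : cokernel :=
  (\pi_(Quotient.quot (GRing.ZmodClosed.clone B in_range _)) y)%qT.

Lemma coker_proj_surj q : exists y, coker_proj y = q.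
Proof. by exists (repr q); rewrite /coker_proj reprK. Qed.

Lemma coker_projD : {morph coker_proj : x y / x + y}.
Proof. by move=> x y; rewrite /coker_proj raddfD. Qed.

Lemma coker_proj_eq x y : coker_proj x = coker_proj y <-> x - y \in in_range.
Proof.
rewrite (Quotient.idealrBE (GRing.ZmodClosed.clone B in_range _) x y).
by split=> [xy|/eqP]; first exact/eqP.
Qed.

Definition coker_scale k (q : cokernel) : cokernel := coker_proj (k *: repr q).

(** Independence of the representative: [repr (coker_proj y)] and [y] differ by an element of the
    image, which is stable under scaling. The module axioms then descend from [B]. *)
Lemma coker_scale_proj k y : coker_scale k (coker_proj y) = coker_proj (k *: y).
Proof.
apply/coker_proj_eq; rewrite -scalerBr rpredZ //; apply/coker_proj_eq.
by rewrite /coker_proj reprK.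
Qed.

Lemma coker_scaleA a b v :
  coker_scale a (coker_scale b v) = coker_scale (a * b) v.
Proof.
by have [y <-] := coker_proj_surj v; rewrite !coker_scale_proj scalerA.
Qed.

Lemma coker_scale1 : left_id 1 coker_scale.
Proof.
by move=> v; have [y <-] := coker_proj_surj v; rewrite coker_scale_proj scale1r.
Qed.

Lemma coker_scaleDr : right_distributive coker_scale +%R.
Proof.
move=> k u v; have [x <-] := coker_proj_surj u; have [y <-] := coker_proj_surj v.
by rewrite -coker_projD !coker_scale_proj scalerDr coker_projD.
Qed.

Lemma coker_scaleDl v : {morph coker_scale^~ v : a b / a + b}.
Proof.
move=> a b; have [y <-] := coker_proj_surj v.
by rewrite !coker_scale_proj scalerDl coker_projD.
Qed.

HB.instance Definition _ := GRing.Zmodule_isLmodule.Build R cokernel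
  coker_scaleA coker_scale1 coker_scaleDr coker_scaleDl.

Lemma coker_proj_linear : linear coker_proj.
Proof. by move=> k x y; rewrite coker_projD -coker_scale_proj. Qed.

HB.instance Definition _ := GRing.isLinear.Build R B cokernel *:%R coker_proj
  coker_proj_linear.

Lemma coker_proj_eq0 y : coker_proj y = 0 <-> exists x, f x = y.
Proof.
rewrite -(linear0 coker_proj) coker_proj_eq subr0.
by split=> /in_rangeP.
Qed.

End ImageCokernel.

(** * Free modules on arbitrary sets of generators *)

Section FreeModule.
Variables (R : pzRingType) (T : choiceType).

Definition finsupp_fun (x : T -> R^o) : bool :=
  `[< finite_set [set t | x t != 0] >].

Lemma finsupp_submod_closed : GRing.submod_closed finsupp_fun.
Proof.
split=> [|k x y /asboolP finx /asboolP finy]; apply/asboolP.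
  by apply: (sub_finite_set _ (finite_set0 _)) => t /=; rewrite eqxx.
have finxy : finite_set ([set t | x t != 0] `|` [set t | y t != 0]).
  by rewrite finite_setU.
apply: sub_finite_set finxy => t /=.
rewrite (_ : (k *: x + y) t = k * x t + y t) //.
have [->|] := eqVneq (x t) 0; last by left.
by have [->|] := eqVneq (y t) 0; [rewrite mulr0 addr0 eqxx|right].
Qed.

HB.instance Definition _ := GRing.isSubmodClosed.Build R (T -> R^o) finsupp_fun
  (GRing.submod_closed_semi finsupp_submod_closed).

Record free_module := FreeModule {
  coef :> T -> R^o; _ : coef \in finsupp_fun }.
HB.instance Definition _ := [isSub for coef].
HB.instance Definition _ := [Choice of free_module by <:].
HB.instance Definition _ := [SubChoice_isSubLmodule of free_module by <:].

Definition supp (x : free_module) : {fset T} := fset_set [set t | x t != 0].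

Lemma mem_supp x t : (t \in supp x) = (x t != 0).
Proof.
rewrite in_fset_set; last by case: x => x /= /asboolP.
by apply/idP/idP => [/set_mem|/mem_set].
Qed.

Lemma free_gen_subproof (t : T) : (fun u => (u == t)%:R : R^o) \in finsupp_fun.
Proof.
apply/asboolP; apply: (sub_finite_set _ (finite_set1 t)) => u /=.
by case: (u =P t) => // _; rewrite eqxx.
Qed.

Definition free_gen t : free_module := FreeModule (free_gen_subproof t).

Lemma coefP k (x y : free_module) t : (k *: x + y) t = k * x t + y t.
Proof. by []. Qed.

Section Lift.
Variables (A : lmodType R) (h : T -> A).

Definition free_lift (x : free_module) : A :=
  \sum_(t <- supp x) (x t : R) *: h t.

(** Enlarging the index set lets the sums for [x], [y] and [k *: x + y] run over one common set. *)
Lemma free_liftE (F : {fset T}) (x : free_module) :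
  (supp x `<=` F)%fset -> free_lift x = \sum_(t <- F) (x t : R) *: h t.
Proof.
move=> suppF; apply: big_fset_incl => // t _; rewrite mem_supp negbK.
by move=> /eqP ->; rewrite scale0r.
Qed.

Lemma free_lift_linear : linear free_lift.
Proof.
move=> k x y; pose F := (supp x `|` supp y)%fset.
rewrite (free_liftE (F := F) (x := x)) ?fsubsetUl //.
rewrite (free_liftE (F := F) (x := y)) ?fsubsetUr //.
rewrite (free_liftE (F := F)); last first.
  apply/fsubsetP => t; rewrite inE !mem_supp coefP.
  have [->|//] := eqVneq (x t) 0; have [->|//] := eqVneq (y t) 0.
  by rewrite mulr0 addr0 eqxx.
rewrite scaler_sumr -big_split; apply: eq_bigr => t _.
by rewrite coefP scalerDl scalerA.
Qed.

HB.instance Definition _ := GRing.isLinear.Build R free_module A *:%R free_lift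
  free_lift_linear.

Lemma free_lift_gen t : free_lift (free_gen t) = h t.
Proof.
rewrite (free_liftE (F := [fset t]%fset)); last first.
  apply/fsubsetP => u.
  by rewrite mem_supp inE /=; case: (u =P t) => // _; rewrite eqxx.
by rewrite big_seq_fset1 /= eqxx scale1r.
Qed.

End Lift.

Lemma free_lift_id x : free_lift free_gen x = x.
Proof.
apply: val_inj; apply: funext => u /=.
have coef_sum (s : seq T) :
    (\sum_(t <- s) (x t : R) *: free_gen t) u = \sum_(t <- s) x t * (u == t)%:R.
  by elim: s => [|t s IHs]; rewrite ?big_nil ?big_cons // coefP IHs.
rewrite /free_lift coef_sum; have [ux|] := boolP (u \in supp x).
  rewrite (bigD1_seq u) ?fset_uniq //= eqxx mulr1 big1 ?addr0 // => t.
  by rewrite eq_sym => /negPf ->; rewrite mulr0.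
move=> ux; rewrite big_seq big1 => [|t tx].
  by apply/esym/eqP; rewrite mem_supp negbK in ux.
by case: eqP ux => [->|_ _]; rewrite ?tx ?mulr0.
Qed.

Lemma projective_free : projective free_module.
Proof.
move=> A B p f surj_p.
have /choice[c cP] (t : T) : exists a, p a = f (free_gen t).
  have [a _ <-] : range p (f (free_gen t)) by rewrite surj_p.
  by exists a.
exists (free_lift c) => x /=; rewrite -[in RHS](free_lift_id x) !linear_sum.
by apply: eq_bigr => t _; rewrite !linearZ cP.
Qed.

End FreeModule.

(** * Free resolutions, vanishing of Ext, and regularity *)

Section Resolutions.
Variable R : pzRingType.
Implicit Types A B C F I M V : lmodType R.

Lemma exact_atP A B C (f : {linear A -> B}) (g : {linear B -> C}) :
  exact_at f g <-> forall y, g y = 0 <-> exists x, f x = y.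
Proof.
split=> [ex y|ex].
  split=> [gy0|[x <-]].
    have : linear_ker g y by [].
    by rewrite -ex => -[x _ <-]; exists x.
  by have : linear_ker g (f x) by rewrite -ex; exists x.
apply/seteqP; split=> [_ [x _ <-]|y gy0] /=; first by apply/ex; exists x.
by have [x <-] := (ex y).1 gy0; exists x.
Qed.

(** Taking all of [A] as generators and sending those outside the kernel to 0 avoids forming the
    kernel as a module. *)
Definition kernel_cover A B (d : {linear A -> B}) :
    {linear free_module R A -> A} :=
  free_lift (fun a => if d a == 0 then a else 0).

Lemma kernel_cover_exact A B (d : {linear A -> B}) : exact_at (kernel_cover d) d.
Proof.
apply/exact_atP => y; split=> [dy0|[x <-]].
  by exists (free_gen R y); rewrite /kernel_cover /= free_lift_gen dy0 eqxx.
rewrite linear_sum big1_seq // => t _; rewrite linearZ.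
by case: ifP => [/eqP dt|_]; rewrite /= ?dt ?linear0 scaler0.
Qed.

(** Bundling source and target allows iteration although the modules change at each stage. *)
Record arrow := Arrow {
  src : lmodType R; tgt : lmodType R; map_of : {linear src -> tgt} }.

Definition kernel_arrow (d : arrow) := Arrow (kernel_cover (map_of d)).

(** Stage 0 is the augmentation, so the differential of index [n] is stage [n.+1]; its target is the
    source of stage [n] by computation. *)
Definition syzygy A F (aug : {linear A -> F}) n :=
  iter n kernel_arrow (Arrow aug).

Lemma syzygy_projective A F (aug : {linear A -> F}) n :
  projective A -> projective (src (syzygy aug n)).
Proof. by case: n => [//|n] _; apply: projective_free. Qed.

Definition syzygy_resolution A F (aug : {linear A -> F}) (projA : projective A)
    (surj_aug : range aug = setT) : projective_resolution F :=
  @ProjectiveResolution R F (fun n => src (syzygy aug n))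
    (fun n => map_of (syzygy aug n.+1)) aug
    (fun n => @syzygy_projective _ _ aug n projA)
    (fun n => kernel_cover_exact (map_of (syzygy aug n.+1)))
    (kernel_cover_exact aug) surj_aug.

(** For a section [s] of the augmentation, [1 - s aug] maps into the image of the differential [d]
    of index 0. A cocycle [f] vanishes on the kernel of [d], so [f d^-1 (1 - s aug)] is a
    well-defined map; composed with [d] it gives [f], because [aug d = 0]. *)
Lemma projective_Ext1_eq0 F I : projective F -> Ext1_eq0 F I.
Proof.
move=> projF P f cocyc.
have [s augs] := projF _ _ (res_aug P) idfun (res_aug_surj P).
have [] := @linear_lift R _ _ _ _ (res_diff P 0) f (idfun \- (s \o res_aug P)).
- by move=> a /((exact_atP _ _).1 (res_exact P 0) _).1[x <-].
- move=> c; apply/((exact_atP _ _).1 (res_exact0 P)).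
  by rewrite /= linearB; have /= -> := augs (res_aug P c); rewrite subrr.
move=> g gE; exists g => x; apply/esym/gE => /=.
have -> : res_aug P (res_diff P 0 x) = 0.
  by apply/((exact_atP _ _).1 (res_exact0 P)); exists x.
by rewrite linear0 subr0.
Qed.

(** Let [A] be the matrix of [f] and [A = A X A]. The map [y - y X A] kills the image of [f], hence
    factors through [g] as a map [s]. Since [y X A] lies in that image, [g s = 1], and [F] is a
    retract of a free module. *)
Lemma regular_fp_projective F :
  von_neumann_regular R -> finitely_presented F -> projective F.
Proof.
move=> regR [m [n [f [g [exfg surj_g]]]]].
have [X AX] := mx_regular_all regR (lin1_mx f).
have [] := @linear_lift R _ _ _ _ g
  (idfun \- mulmxr (X *m lin1_mx f) : {linear 'rV_n -> 'rV_n})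
  (idfun : {linear F -> F}).
- move=> a /((exact_atP _ _).1 exfg _).1[x <-] /=.
  by rewrite -mul_rV_lin1 -mulmxA [lin1_mx f *m _]mulmxA -AX subrr.
- by move=> z; have [y _ <-] : range g z; [rewrite surj_g|exists y].
move=> s sE A B p h surj_p.
have [u pu] := projective_rV (h \o g) surj_p.
exists (u \o s) => z /=; have [y _ gyz] : range g z by rewrite surj_g.
have /= -> := pu (s z); rewrite (sE z y) //=.
rewrite linearB /= gyz; have -> : g (y *m (X *m lin1_mx f)) = 0.
  by rewrite mulmxA mul_rV_lin1; apply/((exact_atP _ _).1 exfg); eexists.
by rewrite subr0.
Qed.

Lemma regular_fp_injective M : von_neumann_regular R -> fp_injective M.
Proof.
by move=> regR F fpF; apply/projective_Ext1_eq0/regular_fp_projective.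
Qed.

Lemma fp_injective_retract I V (i : {linear I -> V}) (p : {linear V -> I}) :
  cancel i p -> fp_injective V -> fp_injective I.
Proof.
move=> ip fpV F fpF P f cocyc.
have [|g gE] := fpV F fpF P (i \o f).
  by move=> x /=; rewrite cocyc linear0.
by exists (p \o g) => x /=; have /= <- := gE x; rewrite ip.
Qed.

(** In a resolution of the cokernel starting with [coker_proj f], the first differential corestricts
    to the image of [f]. This corestriction is a cocycle, and a map exhibiting it as a coboundary is
    a retraction onto the image. *)
Lemma fp_injective_image_retract m n (f : {linear 'rV[R]_m -> 'rV[R]_n}) :
  fp_injective (image_module f) ->
  exists g : {linear 'rV_n -> image_module f}, forall x, val (g (f x)) = f x.
Proof.
pose aug : {linear 'rV_n -> cokernel f} := coker_proj f.
have surj_aug : range aug = setT.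
  by apply/seteqP; split=> // q _; have [y <-] := coker_proj_surj q; exists y.
have exfaug y : aug y = 0 <-> exists x, f x = y by apply: coker_proj_eq0.
move=> fpI; have ext : Ext1_eq0 (cokernel f) (image_module f).
  by apply: fpI; exists m, n, f, aug; split=> //; apply/exact_atP.
pose P := syzygy_resolution (@projective_rV R n) surj_aug.
have daug y : aug y = 0 <-> exists x, res_diff P 0 x = y.
  exact: (exact_atP _ _).1 (res_exact0 P) y.
(* The corestriction arises by inverting the inclusion [val] along the differential. *)
have [] := @linear_lift R _ _ _ _ (val : {linear image_module f -> 'rV_n}) idfun
  (res_diff P 0).
- by move=> x x0; apply: val_inj.
- move=> c; have [|x fx] := (exfaug (res_diff P 0 c)).1.
    by apply/daug; exists c.
  have dcf : res_diff P 0 c \in in_range f by apply/in_rangeP; exists x.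
  by exists (ImageModule dcf).
move=> d dE; have [x|g gE] := ext P d.
  apply: dE; rewrite linear0; apply/esym.
  by apply/((exact_atP _ _).1 (res_exact P 0)); exists x.
exists g => x; have [|y dy] := (daug (f x)).1; first by apply/exfaug; exists x.
have fxf : f x \in in_range f by apply/in_rangeP; exists x.
by rewrite -dy -[g _](gE y) (dE y (ImageModule fxf)).
Qed.

(* If [M] maps onto [R], the maps out of [M] cover all of [V], so a trace
   submodule of [V] isomorphic to [M] can only be [V] itself. *)
Lemma trace_up_to_iso_surj M V (e : {linear M -> R^o}) (m1 : M) :
  e m1 = 1 -> trace_up_to_iso M V ->
  exists (i : {linear M -> V}) (p : {linear V -> M}), cancel i p.
Proof.
move=> em1 [i [inj_i [N traceN]]].
have ker_i m : i m = 0 -> m = 0 by rewrite -(linear0 i); apply: inj_i.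
have trace_i (x : V) : trace_module N x -> exists m, i m = x.
  by rewrite -traceN => -[m _ <-]; exists m.
have surj_i v : exists m, i m = v.
  have [n [alpha [y ym1]]] : trace_module N (i m1) by rewrite -traceN; exists m1.
  (* Each [alpha j] has its values in the trace, which is the image of [i], so it lifts through
     [i]. *)
  have /choice[beta betaE] (j : 'I_n) :
      exists b : {linear N -> M}, forall z, i (b z) = alpha j z.
    have im_alpha z : exists m, i m = alpha j z.
      by apply: trace_i; exists 1%N, (fun=> alpha j), (fun=> z); rewrite big_ord1.
    have [b bE] := linear_lift (f := idfun) ker_i im_alpha.
    by exists b => z; have [m mz] := im_alpha z; rewrite (bE z m).
  (* This map sends [m1], the sum of the [beta j (y j)], to [v]; composing it with the [beta j]
     therefore puts [v] in the trace of [N]. *)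
  have lin_v : linear (fun m => (e m : R) *: v).
    by move=> k x z; rewrite linearP scalerDl scalerA.
  apply: trace_i; exists n, (fun j => Linear lin_v \o beta j), y => /=.
  rewrite -(linear_sum (Linear lin_v)) (_ : \sum_j _ = m1) /= ?em1 ?scale1r //.
  by apply: inj_i; rewrite ym1 linear_sum; apply: eq_bigr => j _.
have [p pE] := linear_lift (f := idfun) (h := idfun) ker_i surj_i.
by exists i, p => m; apply: pE.
Qed.

Lemma fp_injective_regular :
  (forall I, fp_injective I) -> von_neumann_regular R.
Proof.
move=> fpI a; pose f : {linear 'rV[R]_1 -> 'rV[R]_1} := mulmxr a%:M.
have [g gE] := fp_injective_image_retract (fpI (image_module f)).
have /in_rangeP[x gx] := valP (g 1%:M).
(* Here [f] is right multiplication by [a] and [g 1 = x a], so [a = g (f 1) = a (g 1) = a x a]. *)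
exists (x 0 0); have := gE 1%:M.
rewrite /= mul1mx -scalemx1 linearZ /= -gx /=.
move=> /(congr1 (fun A : 'rV[R]_1 => A 0 0)).
by rewrite !mxE big_ord1 !mxE eqxx !mulr1n mulr1 mulrA.
Qed.

End Resolutions.

Theorem theorem4p14 (R : pzRingType) :
  von_neumann_regular R <->
  (forall M : lmodType R,
     exists (V : lmodType R) (phi : {linear M -> V}),
       fp_injective_preenvelope phi /\ trace_up_to_iso M V).
Proof.
split=> [regR M|traceM].
  exists M, idfun; split.
    split=> [|V' psi _]; first exact: regular_fp_injective.
    by exists psi.
  exists idfun; split=> //; exists M; apply/seteqP; split=> x _; last by exists x.
  by exists 1%N, (fun=> idfun), (fun=> x); rewrite big_ord1.
apply: fp_injective_regular => I.
have [V [phi [[fpV _] trV]]] := traceM (R^o * I)%type.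
pose e : {linear (R^o * I)%type -> R^o} := fst.
have [i [p ip]] := @trace_up_to_iso_surj _ _ _ e (1, 0) erefl trV.
have lin : linear (fun y : I => (0, y) : (R^o * I)%type).
  (* The first component 0 is rewritten as [k *: 0 + 0] to match the right-hand side. *)
  by move=> k x y; rewrite -[0 in LHS](scaler0 _ k) -[_ *: 0]addr0.
apply: (fp_injective_retract (i := i \o Linear lin) (p := snd \o p)) fpV.
by move=> y /=; rewrite ip.
Qed.
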